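(* Let $n\ge 5$ and $2\le s\le \lfloor \frac{n-1}{2}\rfloor$ be integers, and write $n=\lambda s+\gamma$ with integers $\lambda,\gamma$ and $0\le\gamma<s$. Assume that $n$ and $s$ are odd and $\lambda>\gamma>0$. Then $$\mathrm{diam}(C_n(1,s))=\left\lceil\frac{\lambda}{2}\right\rceil+\frac{s-1}{2}-\left(\min\left(\left\lceil\frac{\gamma+1}{2}\right\rceil,\left\lceil\frac{s-\gamma+2}{2}\right\rceil\right)-1\right).$$
   Context: For integers $n\ge5$ and $2\le s\le\lfloor\frac{n-1}{2}\rfloor$, the circulant graph $C_n(1,s)$ is the graph with vertex set $\{0,1,\ldots,n-1\}$ in which two distinct vertices $i,j$ are adjacent if and only if $|i-j|_n\in\{1,s\}$, where $|x|_n=\min(|x|,n-|x|)$. The distance between two vertices is the length (number of edges) of a shortest path joining them, and $\mathrm{diam}$ is the maximum distance over all pairs of vertices. *)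

(* Defs.v *)
From mathcomp Require Import all_boot all_order all_algebra.

Set Implicit Arguments.
Unset Strict Implicit.
Unset Printing Implicit Defensive.

Section Distance.
Variables (T : finType) (e : rel T).

(* [e]-paths from [x] to [y] without repeated vertices; [k] counts edges. *)
Definition has_path_of_length (x y : T) (k : nat) : bool :=
  [exists p : k.-tuple T,
    [&& path e x p, uniq (x :: p) & last x p == y]].

(* A path without repeated vertices has fewer than #|T| edges, so the value
   #|T| is taken exactly when no path joins [x] to [y]. *)
Definition gdist (x y : T) : nat :=
  \big[minn/#|T|]_(k < #|T| | has_path_of_length x y k) k.

Definition diam : nat := \max_(x : T) \max_(y : T) gdist x y.

Lemma has_path_of_lengthP x y k :
  reflect (exists p : seq T,
             [/\ path e x p, uniq (x :: p), last x p = y & size p = k])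
          (has_path_of_length x y k).
Proof.
apply: (iffP existsP) => [[p /and3P[pp up /eqP lp]] | [p [pp up lp sp]]].
  by exists p; split=> //; rewrite size_tuple.
have sp' : size p == k by apply/eqP.
by exists (Tuple sp'); rewrite pp up /= lp eqxx.
Qed.

Lemma gdist_le_size x y (p : seq T) :
  path e x p -> last x p = y -> gdist x y <= size p.
Proof.
move=> pp lp; case/shortenP: pp lp => p' pp' up' sub lp.
apply: (@leq_trans (size p')); last first.
  by apply: uniq_leq_size => //; case/andP: up'.
have lt_p' : size p' < #|T| by rewrite -[_.+1]/(size (x :: p')) -(card_uniqP up') max_card.
have hp : has_path_of_length x y (size p').
  by apply/has_path_of_lengthP; exists p'.
rewrite /gdist; have := mem_index_enum (Ordinal lt_p').
elim: (index_enum _) => // k r IHr; rewrite big_cons inE.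
case/predU1P=> [<- | /IHr le_r]; first by rewrite hp geq_minl.
by case: ifP => // _; rewrite geq_min le_r orbT.
Qed.

Lemma gdist_attained x y : connect e x y ->
  exists p : seq T, [/\ path e x p, uniq (x :: p), last x p = y
                      & size p = gdist x y].
Proof.
case/connectP=> p0 pp0 ->; case/shortenP: pp0 => p pp up _.
set z := last x p.
have le_p : gdist x z <= size p by exact: gdist_le_size.
have lt_p : size p < #|T| by rewrite -[_.+1]/(size (x :: p)) -(card_uniqP up) max_card.
have : gdist x z = #|T| \/ has_path_of_length x z (gdist x z).
  rewrite /gdist; elim/big_rec: _ => [|k m hk [-> | hm]]; first by left.
    by right; rewrite (minn_idPl (ltnW (ltn_ord k))).
  by right; case: (leqP k m).
case=> [eqT | /has_path_of_lengthP //].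
by rewrite eqT leqNgt lt_p in le_p.
Qed.

End Distance.

(* |x|_n = min(|x|, n - |x|), used only for |x| < n. *)
Definition circ_abs (n : nat) (x : int) : nat :=
  minn (absz x) (n - absz x).

(* The adjacency relation of the circulant graph C_n(1, s). *)
Definition circulant (n s : nat) : rel 'I_n :=
  fun i j => (i != j) && (circ_abs n (i%:Z - j%:Z)%R \in [:: 1; s]).

(* Main.v *)
Require Import Defs.
From mathcomp Require Import all_boot all_order all_algebra.
From mathcomp Require Import zify ring.

(** A walk in C_n(1, s) that makes a net number a of unit steps and a net
    number b of s-steps advances by a + b s modulo n, and steps commute.  So the
    distance between two vertices that differ by z is the least |a| + |b| over
    all integers a, b with a + b s = z mod n ([gdist_circulant_le],
    [gdist_circulant_ge]).  The pairs attached to z form a coset of the plane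
    lattice spanned by (s, -1) and (gamma, lambda), and the diameter is the
    covering radius of that lattice for the l1 norm ([diam_circulant]).

    Write s = 2k + 1 and c for the minimum in the formula.  By the symmetry
    z -> -z it is enough to treat z = q s + r with 0 <= r < s and
    q <= lambda / 2.

    Upper bound ([covering]).  Three coset members suffice: (r, q),
    (r - s, q + 1) and (r - gamma, q - lambda).  The first two cost q + r and
    q + 1 + s - r, so the smaller is at most q + k + 1, and both can be too
    long only if q is within c of lambda / 2 and r lies in a short window around
    k + 1.  The two terms of the minimum are exactly what keeps r - gamma small
    on the two ends of that window.  The oddness of n and s makes lambda and
    gamma of opposite parity, which fixes the rounding.

    Lower bound ([far_point]).  A residue with q = lambda./2 and a suitable r
    is at distance at least the claimed value.  Infinitely many coset members
    have to be excluded; [lattice_half_norm_ge] does it with the linear bounds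
    |a| + |b| >= a + b and |a| + |b| >= b - a, which leave only four cheapest
    candidates when gamma <= lambda. *)

(** * Distances in the circulant graph as l1 norms *)

(** The pairs (a, b) for which z satisfies this predicate form one coset of the
    lattice of all (a, b) with a + b s = 0 mod n. *)
Definition displacement (n s : nat) (z a b : int) : Prop :=
  exists w : int, z = (a + b * s%:Z + w * n%:Z)%R.

Lemma displacementN n s z a b :
  displacement n s z a b -> displacement n s (- z)%R (- a)%R (- b)%R.
Proof. by case=> w ->; exists (- w)%R; ring. Qed.

Lemma displacementD n s z z' a b a' b' :
  displacement n s z a b -> displacement n s z' a' b' ->
  displacement n s (z + z')%R (a + a')%R (b + b')%R.
Proof. by case=> w -> [w' ->]; exists (w + w')%R; ring. Qed.

(** Since 2 s < n, none of 1, -1, s, -s vanishes modulo n, and |.|_n takes the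
    value 1 or s only at these four residues: an edge is a displacement of l1
    norm one. *)
Lemma circulant_displacement n s (i j : 'I_n) : 0 < s -> s.*2 < n ->
  circulant s i j <->
  exists a b, displacement n s (j%:Z - i%:Z)%R a b /\ absz a + absz b = 1.
Proof.
move=> s_gt0 lt_2s_n; have ltin := ltn_ord i; have ltjn := ltn_ord j.
rewrite /circulant /circ_abs !inE; split.
- case/andP=> _ /orP[] /eqP E.
  + have [H|[H|[H|H]]] : (j%:Z - i%:Z = 1 \/ j%:Z - i%:Z = -1 \/
       j%:Z - i%:Z = 1 - n%:Z \/ j%:Z - i%:Z = n%:Z - 1)%R by lia.
    * by exists 1%R, 0%R; split=> //; exists 0%R; lia.
    * by exists (-1)%R, 0%R; split=> //; exists 0%R; lia.
    * by exists 1%R, 0%R; split=> //; exists (-1)%R; lia.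
    * by exists (-1)%R, 0%R; split=> //; exists 1%R; lia.
  + have [H|[H|[H|H]]] : (j%:Z - i%:Z = s%:Z \/ j%:Z - i%:Z = - s%:Z \/
       j%:Z - i%:Z = s%:Z - n%:Z \/ j%:Z - i%:Z = n%:Z - s%:Z)%R by lia.
    * by exists 0%R, 1%R; split=> //; exists 0%R; lia.
    * by exists 0%R, (-1)%R; split=> //; exists 0%R; lia.
    * by exists 0%R, 1%R; split=> //; exists (-1)%R; lia.
    * by exists 0%R, (-1)%R; split=> //; exists 1%R; lia.
- case=> a [b [[w E] nab]].
  have [c [Ec c_le c_neq0 c_val]] : exists c : int,
      [/\ (j%:Z - i%:Z = c + w * n%:Z)%R, absz c <= s, absz c != 0
        & absz c = 1 \/ absz c = s].
    exists (a + b * s%:Z)%R.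
    have [[-> Hb]|[-> Ha]] : (a = 0 /\ (b = 1 \/ b = -1) \/
                             b = 0 /\ (a = 1 \/ a = -1))%R by lia.
      by split; case: Hb => Hb; subst b; lia.
    by split; case: Ha => Ha; subst a; lia.
  have Hw : (w = 0 \/ w = 1 \/ w = -1)%R by nia.
  by rewrite -val_eqE /=; case: Hw => [|[]] Hw; subst w; lia.
Qed.

(** Walk greedily: as long as (a, b) is nonzero, one step brings one of its
    coordinates closer to 0. *)
Lemma displacement_path n s (i j : 'I_n) a b : 0 < s -> s.*2 < n ->
  displacement n s (j%:Z - i%:Z)%R a b ->
  exists p, [/\ path (@circulant n s) i p, last i p = j
              & size p = absz a + absz b].
Proof.
move=> s_gt0 lt_2s_n; move def_k: (absz a + absz b) => k.
elim: k i a b def_k => [|k IHk] i a b def_k.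
  case=> w E; exists [::]; split=> //=; apply: val_inj => /=.
  have [a0 b0] : (a = 0 /\ b = 0)%R by lia.
  have ltin := ltn_ord i; have ltjn := ltn_ord j.
  subst a b; have Hw : (w = 0)%R by nia.
  by subst w; lia.
move=> Hij.
have [a1 [b1 [n1 n2]]] : exists a1 b1 : int, absz a1 + absz b1 = 1 /\
    absz (a - a1)%R + absz (b - b1)%R = k.
  have [a_lt0|[a_gt0|a0]] : (a < 0 \/ 0 < a \/ a = 0)%R by lia.
  - by exists (-1)%R, 0%R; lia.
  - by exists 1%R, 0%R; lia.
  - have [b_lt0|[b_gt0|b0]] : (b < 0 \/ 0 < b \/ b = 0)%R by lia.
    + by exists 0%R, (-1)%R; lia.
    + by exists 0%R, 1%R; lia.
    + by lia.
have n_gt0 : 0 < n by lia.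
pose y : int := (i%:Z + a1 + b1 * s%:Z)%R.
have [m [w [lt_mn Em]]] : exists (m : nat) w, m < n /\ (m%:Z = y + w * n%:Z)%R.
  exists (absz (y %% n%:Z)%Z), (- (y %/ n%:Z)%Z)%R.
  have := divz_eq y n%:Z; have := ltz_pmod y (_ : 0 < n%:Z)%R.
  have := modz_ge0 y (_ : n%:Z != 0)%R.
  by lia.
pose i1 := Ordinal lt_mn.
have step : displacement n s (i1%:Z - i%:Z)%R a1 b1.
  by exists w; rewrite /= Em /y; ring.
have [] := IHk i1 _ _ n2.
  have -> : (j%:Z - i1%:Z = (j%:Z - i%:Z) + - (i1%:Z - i%:Z))%R by ring.
  exact/displacementD/displacementN.
move=> p [pp lp sp]; exists (i1 :: p); split=> //=; last by rewrite sp.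
by rewrite pp andbT; apply/circulant_displacement => //; exists a1, b1.
Qed.

Lemma path_displacement n s (i : 'I_n) p : 0 < s -> s.*2 < n ->
  path (@circulant n s) i p ->
  exists a b, displacement n s ((last i p)%:Z - i%:Z)%R a b
              /\ absz a + absz b <= size p.
Proof.
move=> s_gt0 lt_2s_n; elim: p i => [|i1 p IHp] i /=.
  by exists 0%R, 0%R; split=> //; exists 0%R; ring.
case/andP=> /circulant_displacement[]// a1 [b1 [D1 n1]] /IHp[a [b [D nab]]].
exists (a1 + a)%R, (b1 + b)%R; split; last by lia.
have -> : ((last i1 p)%:Z - i%:Z = (i1%:Z - i%:Z) + ((last i1 p)%:Z - i1%:Z))%R
  by ring.
exact: displacementD.
Qed.

Lemma gdist_circulant_le n s (i j : 'I_n) a b : 0 < s -> s.*2 < n ->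
  displacement n s (j%:Z - i%:Z)%R a b ->
  gdist (@circulant n s) i j <= absz a + absz b.
Proof.
move=> s_gt0 lt_2s_n /displacement_path[]// p [pp lp <-].
exact: gdist_le_size.
Qed.

Lemma gdist_circulant_ge n s (i j : 'I_n) d : 0 < s -> s.*2 < n ->
  (forall a b, displacement n s (j%:Z - i%:Z)%R a b -> d <= absz a + absz b) ->
  d <= gdist (@circulant n s) i j.
Proof.
move=> s_gt0 lt_2s_n d_le.
have conn : connect (@circulant n s) i j.
  have [|p [pp lp _]] := @displacement_path n s i j (j%:Z - i%:Z)%R 0%R s_gt0 lt_2s_n.
    by exists 0%R; ring.
  by apply/connectP; exists p.
have [p [pp _ lp <-]] := gdist_attained conn.
have [a [b [D nab]]] := path_displacement _ _ _ _ s_gt0 lt_2s_n pp.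
by rewrite lp in D; apply: leq_trans (d_le _ _ D) nab.
Qed.

(** The diameter as a covering radius.  Covering the residues up to n / 2 is
    enough, because every difference of vertices is congruent to some u or -u in
    that range and (a, b) -> (-a, -b) preserves the norm. *)
Lemma diam_circulant n s d x : 0 < s -> s.*2 < n -> x < n ->
  (forall u, u.*2 <= n ->
    exists a b, displacement n s (u%:Z)%R a b /\ absz a + absz b <= d) ->
  (forall a b, displacement n s (x%:Z)%R a b -> d <= absz a + absz b) ->
  diam (@circulant n s) = d.
Proof.
move=> s_gt0 lt_2s_n lt_xn cover far; apply/eqP; rewrite eqn_leq; apply/andP.
split.
  apply/bigmax_leqP => i _; apply/bigmax_leqP => j _.
  have ltin := ltn_ord i; have ltjn := ltn_ord j.
  suff [a [b [D nab]]] : exists a b,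
      displacement n s (j%:Z - i%:Z)%R a b /\ absz a + absz b <= d.
    exact: leq_trans (gdist_circulant_le _ _ _ _ _ _ s_gt0 lt_2s_n D) nab.
  have [u [u_le [v f_u]]] : exists u : nat, u.*2 <= n /\ exists v : int,
     (j%:Z - i%:Z = u%:Z + v * n%:Z \/ j%:Z - i%:Z = - u%:Z + v * n%:Z)%R.
    pose u := absz (j%:Z - i%:Z)%R.
    case: (leqP u.*2 n) => u2; first by exists u; split=> //; exists 0%R; lia.
    exists (n - u); split; first by lia.
    case: (leqP i j) => ij; first by exists 1%R; lia.
    by exists (-1)%R; lia.
  have [a [b [[w D] nab]]] := cover u u_le; case: f_u => f_u.
    by exists a, b; split=> //; exists (w + v)%R; rewrite f_u D; ring.
  by exists (- a)%R, (- b)%R; split; [exists (v - w)%R; rewrite f_u D; ring | lia].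
have n_gt0 : 0 < n by lia.
apply: leq_trans (leq_bigmax (Ordinal n_gt0)).
apply: leq_trans (leq_bigmax (Ordinal lt_xn)).
by apply: gdist_circulant_ge => //= a b; rewrite GRing.subr0; apply: far.
Qed.

(** * Norms in a coset of the lattice *)

(** With l >= 0, the form a + b grows with l and with m, since (s, -1) has a
    nonnegative coordinate sum; the form b - a grows with l, because
    gamma <= lambda, and decreases with m.  Using the first form for m >= M and
    the second for m < M reduces the whole half-lattice to its members
    (l, m) = (0, M) and (0, M - 1). *)
Lemma lattice_half_norm_ge (r q s lambda gamma d l m M : int) :
  (0 <= l -> 1 <= s -> 0 <= gamma <= lambda ->
   d <= q + r + M * (s - 1) -> d <= q - r + (1 - M) * (s + 1) ->
   d <= `|r + l * gamma + m * s| + `|q + l * lambda - m|)%R.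
Proof.
move=> l_ge0 s_ge1 /andP[g_ge0 g_le] d1 d2.
have [le_Mm|lt_mM] : (M <= m \/ m < M)%R by lia.
  have : (0 <= l * (gamma + lambda))%R by nia.
  have : (0 <= (m - M) * (s - 1))%R by nia.
  by lia.
have : (0 <= l * (lambda - gamma))%R by nia.
have : (0 <= (M - 1 - m) * (s + 1))%R by nia.
by lia.
Qed.

(** The members r + l gamma + m s, q + l lambda - m of a coset with l >= 0 form
    one half-lattice; the negatives of those with l < 0 form another one, based
    at (gamma - r, lambda - q).  The split is made at 0 on the first half and at
    M on the second, so that M can depend on the sign of gamma - r. *)
Lemma lattice_coset_norm_ge n s lambda gamma (r q M d a b : int) :
  n = lambda * s + gamma -> 0 < s -> gamma <= lambda ->
  (d <= q + r -> d <= q - r + (s%:Z + 1) ->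
   d <= (lambda%:Z - q) + (gamma%:Z - r) + M * (s%:Z - 1) ->
   d <= (lambda%:Z - q) - (gamma%:Z - r) + (1 - M) * (s%:Z + 1) ->
   displacement n s (r + q * s%:Z) a b -> d <= `|a| + `|b|)%R.
Proof.
move=> -> s_gt0 le_gl d1 d2 d3 d4 [w E].
have [w_le0|w_gt0] : (w <= 0 \/ 0 < w)%R by lia.
  have := @lattice_half_norm_ge r q s%:Z lambda%:Z gamma%:Z d (- w)
     (q - w * lambda%:Z - b)%R 0%R.
  have -> : (a = r + (- w) * gamma%:Z + (q - w * lambda%:Z - b) * s%:Z)%R.
    by rewrite PoszD PoszM in E; lia.
  have -> : (q + - w * lambda%:Z - (q - w * lambda%:Z - b) = b)%R by ring.
  by apply; lia.
have := @lattice_half_norm_ge (gamma%:Z - r) (lambda%:Z - q) s%:Z lambda%:Z gamma%:Z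
   d (w - 1) (w * lambda%:Z - q + b)%R M.
have -> : (gamma%:Z - r + (w - 1) * gamma%:Z + (w * lambda%:Z - q + b) * s%:Z
   = - a)%R.
  by rewrite PoszD PoszM in E; lia.
have -> : (lambda%:Z - q + (w - 1) * lambda%:Z - (w * lambda%:Z - q + b) = - b)%R
  by ring.
by rewrite !Num.Theory.normrN; apply; lia.
Qed.

(** * Covering radius for odd n and s *)

Definition odd_diam (s lambda gamma : nat) : nat :=
  uphalf lambda + (s - 1) %/ 2
    - (minn (uphalf (gamma + 1)) (uphalf (s - gamma + 2)) - 1).

Lemma odd_quotient_remainder n s lambda gamma :
  n = lambda * s + gamma -> odd n -> odd s -> odd lambda = ~~ odd gamma.
Proof.
by move=> -> + hsodd; rewrite oddD oddM hsodd; case: odd; case: odd.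
Qed.

(** If both (r, q) and (r - s, q + 1) are longer than the bound D, then r lies in
    an interval around k + 1 of half-width less than c - (lambda / 2 - q); there
    2 c <= gamma + 1 (up to rounding) bounds r - gamma from above and
    2 c <= s - gamma + 2 (up to rounding) from below, so that
    (r - gamma, q - lambda) has norm at most D. *)
Lemma covering n s lambda gamma u :
  n = lambda * s + gamma -> gamma < s -> odd n -> odd s -> u.*2 <= n ->
  exists a b, displacement n s (u%:Z)%R a b /\
    absz a + absz b <= odd_diam s lambda gamma.
Proof.
move=> hdiv hgamma hnodd hsodd u2n.
set D := odd_diam s lambda gamma.
have par := odd_quotient_remainder _ _ _ _ hdiv hnodd hsodd.
have s_gt0 : 0 < s by lia.
have Eu := divn_eq u s; have r_lt := ltn_pmod u s_gt0.
move: (u %/ s) (u %% s) Eu r_lt => q r Eu r_lt.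
have q_le : q.*2 <= lambda by nia.
have [H|[H|H]] : q + r <= D \/ q + 1 + s - r <= D \/
   (lambda - q) + absz (r%:Z - gamma%:Z)%R <= D.
  by rewrite /D /odd_diam; lia.
- exists (r%:Z)%R, (q%:Z)%R; split; last by lia.
  by exists 0%R; rewrite Eu; lia.
- exists (r%:Z - s%:Z)%R, (q%:Z + 1)%R; split; last by lia.
  by exists 0%R; rewrite Eu; lia.
- exists (r%:Z - gamma%:Z)%R, (q%:Z - lambda%:Z)%R; split; last by lia.
  by exists 1%R; rewrite Eu hdiv; lia.
Qed.

(** The residue is taken with q = lambda./2, where the two halves of the coset
    balance.  The term that realizes the minimum decides whether r is put near
    the upper or the lower end of the interval of radius about c around k + 1
    in which (r, q) and (r - s, q + 1) are both long. *)
Lemma far_point n s lambda gamma :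
  n = lambda * s + gamma -> gamma < s -> odd n -> odd s ->
  1 < lambda -> 0 < gamma <= lambda ->
  exists x, x < n /\
    forall a b, displacement n s (x%:Z)%R a b ->
      odd_diam s lambda gamma <= absz a + absz b.
Proof.
move=> hdiv hgamma hnodd hsodd lambda_gt1 /andP[g_gt0 le_gl].
have par := odd_quotient_remainder _ _ _ _ hdiv hnodd hsodd.
set D := odd_diam s lambda gamma.
have s_gt0 : 0 < s by lia.
have [r [M [r_le r_ok]]] : exists (r : nat) (M : int), r <= s /\
   [/\ D%:Z <= lambda./2%:Z + r%:Z,
      D%:Z <= lambda./2%:Z - r%:Z + (s%:Z + 1),
      D%:Z <= (lambda%:Z - lambda./2%:Z) + (gamma%:Z - r%:Z) + M * (s%:Z - 1)
    & D%:Z <= (lambda%:Z - lambda./2%:Z) - (gamma%:Z - r%:Z)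
              + (1 - M) * (s%:Z + 1)]%R.
  (* With c the minimum, r = k + c when the first term is the smaller; then
     r >= gamma, and the cheap members of the second half are those for m = 0
     and m = 1.  Otherwise r = k + 1 - c, raised by one when gamma is even
     because lambda./2 then rounds down; then the cheap members are those for
     m = -1 and m = 0. *)
  case: (leqP (uphalf (gamma + 1)) (uphalf (s - gamma + 2))) => cmp.
    exists (s./2 + uphalf (gamma + 1)), 1%R.
    by rewrite /D /odd_diam; split; [|split]; lia.
  exists (s./2 + 1 + ~~ odd gamma - uphalf (s - gamma + 2)), 0%R.
  by rewrite /D /odd_diam; split; [|split]; lia.
exists (lambda./2 * s + r); split; first by nia.
case: r_ok => d1 d2 d3 d4 a b Dab.
have := lattice_coset_norm_ge _ _ _ _ _ _ M (D%:Z)%R a b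
  hdiv s_gt0 le_gl d1 d2 d3 d4.
have -> : (r%:Z + lambda./2%:Z * s%:Z = (lambda./2 * s + r)%N%:Z)%R by lia.
by move/(_ Dab); lia.
Qed.

Theorem theorem3p10 (n s lambda gamma : nat)
  (hn : 5 <= n) (hs2 : 2 <= s) (hs : s <= (n - 1) %/ 2)
  (hdiv : n = lambda * s + gamma) (hgamma : gamma < s)
  (hnodd : odd n) (hsodd : odd s)
  (hlg : gamma < lambda) (hg0 : 0 < gamma) :
  diam (@circulant n s) =
    uphalf lambda + (s - 1) %/ 2
      - (minn (uphalf (gamma + 1)) (uphalf (s - gamma + 2)) - 1).
Proof.
have lambda_gt1 : 1 < lambda by lia.
have s_gt0 : 0 < s by lia.
have lt_2s_n : s.*2 < n by lia.
have gl : 0 < gamma <= lambda by lia.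
have [x [lt_xn far]] := far_point _ _ _ _ hdiv hgamma hnodd hsodd
  lambda_gt1 gl.
apply: (diam_circulant n s _ x) => // u.
exact: (covering _ _ lambda gamma).
Qed.
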